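(* Let $h\in C_0^\infty(\mathbb{R}_+)'$ and let $\sigma=(\mathsf{L}^* )^{-1}h\in\mathcal{Y}'$ be its sigma-function. Then the identity $$\langle h,\ \bar f_1\star f_2\rangle=\langle \sigma,\ (\mathsf{L}f_1)^*\,\mathsf{L}f_2\rangle$$ holds for arbitrary $f_1,f_2\in C_0^\infty(\mathbb{R}_+)$.
   Context: $\mathbb{R}_+=(0,\infty)$. For a space of test functions $X$, $X'$ denotes the space of continuous antilinear functionals on $X$; the duality $\langle h,F\rangle$ is linear in the first and antilinear in the second argument, so that $\langle h,F\rangle=\int h(t)\overline{F(t)}\,dt$ when $h$ is a locally integrable function. The space $\mathcal{Y}$ consists of entire functions $\varphi(\lambda)$ satisfying, for all $\lambda\in\mathbb{C}$, the bounds $|\varphi(\lambda)|\le C_n(1+|\lambda|)^{-n}e^{r_\pm|\operatorname{Re}\lambda|}$ for $\pm\operatorname{Re}\lambda\ge 0$, for all $n$, with some $r_+=r_+(\varphi)<0$ and some $r_-=r_-(\varphi)\in\mathbb{R}$. By definition, $\varphi_k\to0$ in $\mathcal{Y}$ if all $\varphi_k$ satisfy these bounds with the same constants $r_\pm,C_n$ and $\varphi_k\to0$ uniformly on compact subsets of $\mathbb{C}$. For $\varphi\in\mathcal{Y}$, $\varphi^*(\lambda)=\overline{\varphi(\bar\lambda)}\in\mathcal{Y}$. The Laplace transform $(\mathsf{L}f)(\lambda)=\int_0^\infty e^{-t\lambda}f(t)\,dt$ is an isomorphism (bijective, continuous with continuous inverse) $\mathsf{L}:C_0^\infty(\mathbb{R}_+)\to\mathcal{Y}$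 (Paley–Wiener). Hence the adjoint $\mathsf{L}^*:\mathcal{Y}'\to C_0^\infty(\mathbb{R}_+)'$, $\langle \mathsf{L}^*\sigma,F\rangle=\langle\sigma,\mathsf{L}F\rangle$, is an isomorphism. For $h\in C_0^\infty(\mathbb{R}_+)'$ its sigma-function is $\sigma=(\mathsf{L}^* )^{-1}h\in\mathcal{Y}'$. The Laplace convolution is $(\bar f_1\star f_2)(t)=\int_0^t\overline{f_1(s)}\,f_2(t-s)\,ds$. *)

(* Defs.v *)
(** Stdlib reals with Coquelicot's complex numbers, derivatives and integrals. *)
From Stdlib Require Import Reals.
From Coquelicot Require Import Coquelicot.
Local Open Scope R_scope.

(** Function spaces are predicates on total functions, and a functional on such
    a space is a total map whose values off the space carry no information. *)

(** ** The test functions [C_0^oo(R_+)], with [R_+ = (0, oo)] *)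

Definition smooth (f : R -> C) : Prop :=
  forall (n : nat) (t : R),
    ex_derive_n (fun s => Re (f s)) n t /\ ex_derive_n (fun s => Im (f s)) n t.

Definition CDerive_n (f : R -> C) (n : nat) (t : R) : C :=
  (Derive_n (fun s => Re (f s)) n t, Derive_n (fun s => Im (f s)) n t).

Definition supported_in (a b : R) (f : R -> C) : Prop :=
  forall t : R, ~ (a <= t <= b) -> f t = RtoC 0.

(** Test functions on (0, oo) are identified with their extensions by zero
    to the whole line. *)
Definition test_function (f : R -> C) : Prop :=
  smooth f /\ exists a b : R, 0 < a /\ a < b /\ supported_in a b f.

Definition test_cvg0 (f : nat -> R -> C) : Prop :=
  (exists a b : R, 0 < a /\ a < b /\ forall k : nat, supported_in a b (f k)) /\
  (forall (n : nat) (eps : R), 0 < eps ->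
     exists N : nat, forall k : nat, (N <= k)%nat ->
       forall t : R, Cmod (CDerive_n (f k) n t) < eps).

(** ** The space [Y] *)

Definition entire (phi : C -> C) : Prop :=
  forall z : C, ex_derive (K := C_AbsRing) (V := C_NormedModule) phi z.

Definition Y_bound (rp rm : R) (Cn : nat -> R) (phi : C -> C) : Prop :=
  forall (n : nat) (z : C),
    (0 <= Re z ->
       Cmod (phi z) <= Cn n * / (1 + Cmod z) ^ n * exp (rp * Rabs (Re z))) /\
    (Re z <= 0 ->
       Cmod (phi z) <= Cn n * / (1 + Cmod z) ^ n * exp (rm * Rabs (Re z))).

Definition Y_space (phi : C -> C) : Prop :=
  entire phi /\
  exists (rp rm : R) (Cn : nat -> R), rp < 0 /\ Y_bound rp rm Cn phi.

(** The compact subsets of [C] are the closed bounded ones. *)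
Definition Y_cvg0 (phi : nat -> C -> C) : Prop :=
  (exists (rp rm : R) (Cn : nat -> R),
     rp < 0 /\ forall k : nat, Y_bound rp rm Cn (phi k)) /\
  (forall K : C -> Prop,
     closed K -> (exists M : R, forall z : C, K z -> Cmod z <= M) ->
     forall eps : R, 0 < eps ->
       exists N : nat, forall k : nat, (N <= k)%nat ->
         forall z : C, K z -> Cmod (phi k z) < eps).

(** ** Continuous antilinear functionals

    Continuity is sequential continuity at 0, which for antilinear functionals
    is sequential continuity; on the LF-space [C_0^oo(R_+)] it is the same as
    topological continuity. *)

Definition antilinear_on {T : Type} (X : (T -> C) -> Prop) (h : (T -> C) -> C)
    : Prop :=
  (forall F G, X F -> X G ->
     h (fun t => Cplus (F t) (G t)) = Cplus (h F) (h G)) /\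
  (forall (c : C) F, X F ->
     h (fun t => Cmult c (F t)) = Cmult (Cconj c) (h F)).

Definition seq_continuous_on {T : Type} (X : (T -> C) -> Prop)
    (cvg0 : (nat -> T -> C) -> Prop) (h : (T -> C) -> C) : Prop :=
  forall F : nat -> T -> C, (forall k : nat, X (F k)) -> cvg0 F ->
    is_lim_seq (fun k => Cmod (h (F k))) 0.

Definition test_dual (h : (R -> C) -> C) : Prop :=
  antilinear_on test_function h /\ seq_continuous_on test_function test_cvg0 h.

Definition Y_dual (sigma : (C -> C) -> C) : Prop :=
  antilinear_on Y_space sigma /\ seq_continuous_on Y_space Y_cvg0 sigma.

Definition pairing {T : Type} (h : (T -> C) -> C) (F : T -> C) : C := h F.

(** ** Laplace transform, its adjoint and the sigma-function *)

Definition Cexp (z : C) : C :=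
  (exp (Re z) * cos (Im z), exp (Re z) * sin (Im z)).

Definition laplace (f : R -> C) (z : C) : C :=
  RInt_gen (V := C_R_CompleteNormedModule)
    (fun t : R => Cmult (Cexp (Copp (Cmult (RtoC t) z))) (f t))
    (at_point 0) (Rbar_locally p_infty).

Definition laplace_adjoint (sigma : (C -> C) -> C) : (R -> C) -> C :=
  fun F => pairing sigma (laplace F).

(** [sigma = (L^* )^{-1} h], written as [L^* sigma = h]; equality in the dual of
    the test functions is equality on all test functions. *)
Definition sigma_function (h : (R -> C) -> C) (sigma : (C -> C) -> C) : Prop :=
  Y_dual sigma /\
  forall F : R -> C, test_function F ->
    pairing (laplace_adjoint sigma) F = pairing h F.

Definition Y_star (phi : C -> C) : C -> C := fun z => Cconj (phi (Cconj z)).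

Definition laplace_conv (f g : R -> C) : R -> C :=
  fun t => RInt (V := C_R_CompleteNormedModule)
             (fun s : R => Cmult (f s) (g (t - s))) 0 t.

(* Main.v *)
(** The kernel [e^{-tz}] is multiplicative in [t], so multiplying by it commutes
    with the convolution, and the Laplace transform of a convolution is the product
    of the transforms as soon as the integral of a convolution is the product of
    the integrals. Since complex conjugation of [f1] turns [laplace f1] into its
    star, the two arguments of [sigma] in the claim agree; that the convolution is
    again a test function lets one pass from [h] to [sigma]. *)
Require Import Defs.
From Stdlib Require Import Reals Lra FunctionalExtensionality.
From Coquelicot Require Import Coquelicot.
Local Open Scope R_scope.

(** * Real integrals: vanishing integrands and continuity in a parameter *)

Lemma RInt_eq_0 (f : R -> R) (a b : R) :
  (forall x, Rmin a b < x < Rmax a b -> f x = 0) -> RInt f a b = 0.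
Proof.
  intros H. rewrite (RInt_ext f (fun _ => 0)) by exact H.
  rewrite RInt_const. apply Rmult_0_r.
Qed.

Lemma ex_RInt_continuous_R (f : R -> R) (a b : R) :
  (forall x, continuous f x) -> ex_RInt f a b.
Proof. intros H. apply (ex_RInt_continuous (V := R_CompleteNormedModule)). auto. Qed.

Lemma RInt_vanishing_right (f : R -> R) (b T : R) :
  (forall x, continuous f x) -> (forall x, b < x -> f x = 0) -> b <= T ->
  RInt f 0 T = RInt f 0 b.
Proof.
  intros Hc Hf HT.
  rewrite <- (RInt_Chasles f 0 b T) by now apply ex_RInt_continuous_R.
  rewrite (RInt_eq_0 f b T).
  - apply Rplus_0_r.
  - intros x Hx. apply Hf. rewrite Rmin_left in Hx; lra.
Qed.

(** On the compact range of integration, joint continuity makes [f y] uniformly close to [f x] for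
    [y] near [x], and the integral inherits the bound. Reversed limits only change the sign. *)
Lemma continuous_RInt_param (f : R -> R -> R) (a b x : R) :
  (forall u v, continuity_2d_pt f u v) ->
  continuous (fun y => RInt (f y) a b) x.
Proof.
  intros Hf.
  assert (Hex : forall y c d, ex_RInt (f y) c d).
  { intros y c d. apply ex_RInt_continuous_R. intros z.
    apply continuity_pt_filterlim. intros eps He.
    destruct (Hf y z (mkposreal eps He)) as [del Hd].
    exists del. split; [apply cond_pos|]. intros w [_ Hw].
    apply Hd; [|exact Hw]. rewrite Rminus_diag, Rabs_R0. apply cond_pos. }
  assert (Hle : forall c d, c <= d -> continuous (fun y => RInt (f y) c d) x).
  { intros c d Hcd. apply continuity_pt_filterlim. intros eps He.
    (* The summand 1 keeps the denominator positive when [c = d]; integrating this bound over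
       [[c, d]] gives at most [eps / 2]. *)
    assert (He' : 0 < eps / (2 * (d - c + 1))) by (apply Rdiv_lt_0_compat; lra).
    destruct (uniform_continuity_2d_1d' f c d x (fun y _ => Hf x y)
                (mkposreal _ He')) as [del Hd].
    exists del. split; [apply cond_pos|]. intros y [_ Hy].
    simpl in Hy |- *. unfold R_dist in *.
    assert (Hn : norm (minus (RInt (f y) c d) (RInt (f x) c d))
                 <= (d - c) * (eps / (2 * (d - c + 1)))).
    { apply (norm_RInt_le_const (fun t => minus (f y t) (f x t)) c d); auto.
      - intros t Ht. left. apply (Hd t x t y); auto.
        + pose proof (cond_pos del); lra.
        + apply Rabs_lt_between' in Hy. lra.
        + rewrite Rminus_diag, Rabs_R0. apply cond_pos.
      - apply (is_RInt_minus (V := R_NormedModule));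
          apply (RInt_correct (V := R_CompleteNormedModule)); auto. }
    eapply Rle_lt_trans; [exact Hn|].
    apply Rle_lt_trans with (eps / 2); [|lra].
    apply Rmult_le_reg_r with (2 * (d - c + 1)); [lra|].
    field_simplify; [|lra]. nra. }
  destruct (Rle_dec a b) as [Hab|Hab]; [now apply Hle|].
  apply continuous_ext with (fun y => opp (RInt (f y) b a)).
  - intros y. apply opp_RInt_swap. apply Hex.
  - apply (continuous_opp (V := R_NormedModule)). apply Hle. lra.
Qed.

(** * Real convolution over a fixed range of integration *)

(** The upper limit is a constant instead of [t], so that differentiation in [t] produces no
    boundary term. For [u] vanishing beyond [b] and [v] vanishing on the nonpositive half-line this
    is the usual convolution. *)
Definition truncated_conv (b : R) (u v : R -> R) (t : R) : R :=
  RInt (fun s => u s * v (t - s)) 0 b.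

Lemma continuity_2d_pt_conv (u v : R -> R) (x y : R) :
  (forall t, continuous u t) -> (forall t, continuous v t) ->
  continuity_2d_pt (fun t s => u s * v (t - s)) x y.
Proof.
  intros Hu Hv. apply continuity_2d_pt_mult.
  - apply (continuity_1d_2d_pt_comp u (fun _ s => s)).
    + apply continuity_pt_filterlim, Hu.
    + apply continuity_2d_pt_id2.
  - apply (continuity_1d_2d_pt_comp v (fun t s => t - s)).
    + apply continuity_pt_filterlim, Hv.
    + apply continuity_2d_pt_minus;
        [apply continuity_2d_pt_id1|apply continuity_2d_pt_id2].
Qed.

Lemma continuous_conv_integrand (u v : R -> R) (t s : R) :
  (forall t, continuous u t) -> (forall t, continuous v t) ->
  continuous (fun s => u s * v (t - s)) s.
Proof.
  intros Hu Hv. apply (continuous_mult (K := R_AbsRing)); [apply Hu|].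
  apply (continuous_comp (fun s => t - s) v); [|apply Hv].
  apply (continuous_minus (V := R_NormedModule));
    [apply continuous_const|apply continuous_id].
Qed.

Lemma continuous_truncated_conv (b : R) (u v : R -> R) (t : R) :
  (forall t, continuous u t) -> (forall t, continuous v t) ->
  continuous (truncated_conv b u v) t.
Proof.
  intros Hu Hv.
  apply (continuous_RInt_param (fun t s => u s * v (t - s))).
  intros x y. now apply continuity_2d_pt_conv.
Qed.

(** Differentiation under the integral sign: [t] enters the integrand through [v] alone, so the
    derivative falls on [v]. *)
Lemma is_derive_truncated_conv (b : R) (u v dv : R -> R) (t : R) :
  (forall t, continuous u t) -> (forall t, continuous dv t) ->
  (forall t, is_derive v t (dv t)) ->
  is_derive (truncated_conv b u v) t (truncated_conv b u dv t).
Proof.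
  intros Hu Hdv Hv.
  assert (Hd : forall s x, is_derive (fun x => u s * v (x - s)) x (u s * dv (x - s))).
  { intros s x. apply (is_derive_scal (fun x => v (x - s))).
    auto_derive; [now exists (dv (x - s))|].
    rewrite Rmult_1_l. now apply is_derive_unique. }
  unfold truncated_conv.
  rewrite (RInt_ext (fun s => u s * dv (t - s))
             (fun s => Derive (fun x => u s * v (x - s)) t))
    by (intros s _; symmetry; now apply is_derive_unique).
  apply (is_derive_RInt_param (fun x s => u s * v (x - s))).
  - apply filter_forall. intros x s _. now exists (u s * dv (x - s)).
  - intros s _. apply continuity_2d_pt_ext with (fun x s => u s * dv (x - s)).
    + intros x y. symmetry. now apply is_derive_unique.
    + now apply continuity_2d_pt_conv.
  - apply filter_forall. intros x. apply ex_RInt_continuous_R. intros s.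
    apply continuous_conv_integrand; [exact Hu|].
    intros y. apply (ex_derive_continuous (K := R_AbsRing) (V := R_NormedModule)). now exists (dv y).
Qed.

(** With [V] the primitive of [v], the function [T => int_0^b u s * V (T - s)]
    is a primitive of the convolution, which replaces Fubini's theorem. *)
Lemma RInt_truncated_conv (b d T : R) (u v : R -> R) :
  0 <= b -> 0 <= d -> b + d <= T ->
  (forall t, continuous u t) -> (forall t, continuous v t) ->
  (forall t, t <= 0 -> v t = 0) -> (forall t, d < t -> v t = 0) ->
  RInt (truncated_conv b u v) 0 T = RInt u 0 b * RInt v 0 d.
Proof.
  intros Hb Hd HT Hu Hv Hv0 Hvd.
  set (V := fun t => RInt v 0 t).
  assert (HV : forall t, is_derive V t (v t)).
  { intros t. apply (is_derive_RInt (V := R_NormedModule) v V 0 t); [|apply Hv].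
    apply filter_forall. intros x.
    apply (RInt_correct (V := R_CompleteNormedModule)).
    now apply ex_RInt_continuous_R. }
  assert (HI : is_RInt (truncated_conv b u v) 0 T
             (minus (truncated_conv b u V T) (truncated_conv b u V 0))).
  { apply (is_RInt_derive (V := R_CompleteNormedModule)).
    - intros x _. now apply is_derive_truncated_conv.
    - intros x _. now apply continuous_truncated_conv. }
  rewrite (is_RInt_unique _ _ _ _ HI).
  (* Here [V] is evaluated at [0 - s < 0], hence integrates [v] over a range where it vanishes. *)
  assert (H0 : truncated_conv b u V 0 = 0).
  { apply RInt_eq_0. intros s Hs. rewrite Rmin_left, Rmax_right in Hs by lra.
    unfold V. rewrite (RInt_eq_0 v 0 (0 - s)); [ring|].
    intros x Hx. apply Hv0. rewrite Rmin_right, Rmax_left in Hx by lra. lra. }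
  (* Since [b + d <= T], every [s < b] gives [T - s > d], where [V] has already reached the full
     integral of [v]. This constant leaves the integral. *)
  assert (H1 : truncated_conv b u V T = RInt u 0 b * RInt v 0 d).
  { unfold truncated_conv.
    rewrite (RInt_ext _ (fun s => scal (RInt v 0 d) (u s))).
    - rewrite (RInt_scal (V := R_CompleteNormedModule))
        by now apply ex_RInt_continuous_R.
      apply Rmult_comm.
    - intros s Hs. rewrite Rmin_left, Rmax_right in Hs by lra. unfold V.
      rewrite (RInt_vanishing_right v d) by (auto; lra). apply Rmult_comm. }
  rewrite H0, H1. apply Rminus_0_r.
Qed.

Definition smooth_R (v : R -> R) : Prop := forall n t, ex_derive_n v n t.

Lemma continuous_Derive_n (v : R -> R) (n : nat) (t : R) :
  smooth_R v -> continuous (Derive_n v n) t.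
Proof. intros Hv. apply (ex_derive_continuous (K := R_AbsRing) (V := R_NormedModule)). apply (Hv (S n)). Qed.

(** Each differentiation replaces [v] by its derivative, so by induction the derivative of order [n]
    is the truncated convolution of [u] with [Derive_n v n]. *)
Lemma smooth_truncated_conv (b : R) (u v : R -> R) :
  (forall t, continuous u t) -> smooth_R v -> smooth_R (truncated_conv b u v).
Proof.
  intros Hu Hv.
  assert (Hd : forall n t, is_derive (truncated_conv b u (Derive_n v n)) t
                             (truncated_conv b u (Derive_n v (S n)) t)).
  { intros n t. apply is_derive_truncated_conv; [exact Hu| |].
    - intros x. now apply continuous_Derive_n.
    - intros x. apply Derive_correct. apply (Hv (S n)). }
  assert (HD : forall n t, Derive_n (truncated_conv b u v) n t
                           = truncated_conv b u (Derive_n v n) t).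
  { induction n as [|n IH]; intros t; [reflexivity|]. simpl.
    rewrite (Derive_ext _ _ t IH). apply is_derive_unique, Hd. }
  intros [|n] t; [exact I|]. simpl.
  apply ex_derive_ext with (truncated_conv b u (Derive_n v n)).
  - intros x. symmetry. apply HD.
  - eexists. apply Hd.
Qed.

(** * Continuity and integration of complex-valued functions *)

(** Stated by components, like [smooth], so that the results on real integrals apply to each part
    directly. *)
Definition continuous_C (f : R -> C) : Prop :=
  forall t, continuous (fun s => Re (f s)) t /\ continuous (fun s => Im (f s)) t.

Lemma continuous_C_Re (f : R -> C) (t : R) :
  continuous_C f -> continuous (fun s => Re (f s)) t.
Proof. intros Hf. exact (proj1 (Hf t)). Qed.

Lemma continuous_C_Im (f : R -> C) (t : R) :
  continuous_C f -> continuous (fun s => Im (f s)) t.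
Proof. intros Hf. exact (proj2 (Hf t)). Qed.

Lemma continuous_C_smooth (f : R -> C) : smooth f -> continuous_C f.
Proof.
  intros Hf t. split; apply (ex_derive_continuous (K := R_AbsRing) (V := R_NormedModule)); apply (Hf 1%nat t).
Qed.

Lemma continuous_C_mult (f g : R -> C) :
  continuous_C f -> continuous_C g -> continuous_C (fun t => Cmult (f t) (g t)).
Proof.
  intros Hf Hg t. destruct (Hf t), (Hg t). split.
  - apply (continuous_minus (V := R_NormedModule));
      now apply (continuous_mult (K := R_AbsRing)).
  - apply (continuous_plus (V := R_NormedModule));
      now apply (continuous_mult (K := R_AbsRing)).
Qed.

Definition CInt (f : R -> C) (a b : R) : C :=
  (RInt (fun t => Re (f t)) a b, RInt (fun t => Im (f t)) a b).

Lemma is_RInt_CInt (f : R -> C) (a b : R) :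
  continuous_C f -> is_RInt (V := C_R_NormedModule) f a b (CInt f a b).
Proof.
  intros Hf.
  apply (is_RInt_fct_extend_pair (U := R_NormedModule) (V := R_NormedModule));
    apply (RInt_correct (V := R_CompleteNormedModule));
    apply ex_RInt_continuous_R; intros x;
    [now apply (continuous_C_Re f)|now apply (continuous_C_Im f)].
Qed.

Lemma RInt_CInt (f : R -> C) (a b : R) :
  continuous_C f -> RInt (V := C_R_CompleteNormedModule) f a b = CInt f a b.
Proof.
  intros Hf. apply (is_RInt_unique (V := C_R_CompleteNormedModule)).
  now apply is_RInt_CInt.
Qed.

Lemma CInt_Cmult (c : C) (f : R -> C) (a b : R) :
  continuous_C f -> CInt (fun t => Cmult c (f t)) a b = Cmult c (CInt f a b).
Proof.
  intros Hf.
  assert (Hex : forall k (g : R -> R), (forall x, continuous g x) ->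
    is_RInt (fun t => k * g t) a b (k * RInt g a b)).
  { intros k g Hg. apply (is_RInt_scal (V := R_NormedModule)).
    apply (RInt_correct (V := R_CompleteNormedModule)).
    now apply ex_RInt_continuous_R. }
  assert (Hr := fun k => Hex k _ (fun x => proj1 (Hf x))).
  assert (Hi := fun k => Hex k _ (fun x => proj2 (Hf x))).
  apply (f_equal2 pair); apply is_RInt_unique.
  - apply (is_RInt_minus (V := R_NormedModule)); [apply Hr|apply Hi].
  - apply (is_RInt_plus (V := R_NormedModule)); [apply Hi|apply Hr].
Qed.

(** Of a support [[a, b]] with [0 < a] only the upper end is recorded: the integrals start at 0 in
    any case. *)
Definition vanishes_outside (b : R) (f : R -> C) : Prop :=
  forall t, t <= 0 \/ b < t -> f t = RtoC 0.

Lemma supported_in_vanishes_outside (a b : R) (f : R -> C) :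
  0 < a -> supported_in a b f -> vanishes_outside b f.
Proof. intros Ha Hf t Ht. apply Hf. lra. Qed.

Lemma CInt_vanishing_right (f : R -> C) (b T : R) :
  continuous_C f -> vanishes_outside b f -> b <= T -> CInt f 0 T = CInt f 0 b.
Proof.
  intros Hc Hf HT. unfold CInt.
  apply (f_equal2 pair); apply RInt_vanishing_right; try assumption; intros x.
  - now apply continuous_C_Re.
  - intros Hx. now rewrite Hf by auto.
  - now apply continuous_C_Im.
  - intros Hx. now rewrite Hf by auto.
Qed.

(** * The Laplace convolution of complex-valued functions and its integral *)

Lemma continuous_C_conv_integrand (f g : R -> C) (t : R) :
  continuous_C f -> continuous_C g ->
  continuous_C (fun s => Cmult (f s) (g (t - s))).
Proof.
  intros Hf Hg. apply continuous_C_mult; [exact Hf|].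
  assert (H : forall s, continuous (fun s => t - s) s).
  { intros s. apply (continuous_minus (V := R_NormedModule));
      [apply continuous_const|apply continuous_id]. }
  intros s. split.
  - apply (continuous_comp (fun s => t - s) (fun x => Re (g x)));
      [apply H|now apply continuous_C_Re].
  - apply (continuous_comp (fun s => t - s) (fun x => Im (g x)));
      [apply H|now apply continuous_C_Im].
Qed.

(* On the part of the range between [t] and [b], one of the factors vanishes. *)
Lemma laplace_conv_CInt (b d : R) (f g : R -> C) (t : R) :
  continuous_C f -> continuous_C g ->
  vanishes_outside b f -> vanishes_outside d g ->
  laplace_conv f g t = CInt (fun s => Cmult (f s) (g (t - s))) 0 b.
Proof.
  intros Hf Hg Hfb Hgd. unfold laplace_conv.
  assert (Hc := continuous_C_conv_integrand f g t Hf Hg).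
  rewrite RInt_CInt by exact Hc.
  assert (Hz : forall s, Rmin t b < s < Rmax t b ->
                 Cmult (f s) (g (t - s)) = RtoC 0).
  { intros s Hs. destruct (Rle_dec t b) as [Htb|Htb].
    - rewrite Rmin_left, Rmax_right in Hs by lra.
      rewrite (Hgd (t - s)) by lra. apply Cmult_0_r.
    - rewrite Rmin_right, Rmax_left in Hs by lra.
      rewrite (Hfb s) by lra. apply Cmult_0_l. }
  assert (HR : forall F : R -> R, (forall x, continuous F x) ->
    (forall s, Rmin t b < s < Rmax t b -> F s = 0) -> RInt F 0 t = RInt F 0 b).
  { intros F HF HF0.
    rewrite <- (RInt_Chasles F 0 t b) by now apply ex_RInt_continuous_R.
    rewrite (RInt_eq_0 F t b HF0). symmetry. apply Rplus_0_r. }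
  apply (f_equal2 pair); apply HR; intros s.
  - now apply (continuous_C_Re (fun s => Cmult (f s) (g (t - s)))).
  - intros Hs. now rewrite Hz.
  - now apply (continuous_C_Im (fun s => Cmult (f s) (g (t - s)))).
  - intros Hs. now rewrite Hz.
Qed.

(** Expanding the complex product reduces the convolution to four real ones, for which continuity,
    derivatives and integrals are already known. *)
Lemma laplace_conv_components (b d : R) (f g : R -> C) (t : R) :
  continuous_C f -> continuous_C g ->
  vanishes_outside b f -> vanishes_outside d g ->
  let fr s := Re (f s) in let fi s := Im (f s) in
  let gr s := Re (g s) in let gi s := Im (g s) in
  laplace_conv f g t =
    (truncated_conv b fr gr t - truncated_conv b fi gi t,
     truncated_conv b fr gi t + truncated_conv b fi gr t).
Proof.
  intros Hf Hg Hfb Hgd fr fi gr gi.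
  rewrite (laplace_conv_CInt b d) by assumption.
  assert (Hex : forall u v : R -> R,
    (forall x, continuous u x) -> (forall x, continuous v x) ->
    is_RInt (fun s => u s * v (t - s)) 0 b (truncated_conv b u v t)).
  { intros u v Hu Hv. apply (RInt_correct (V := R_CompleteNormedModule)).
    apply ex_RInt_continuous_R. intros s. now apply continuous_conv_integrand. }
  assert (Hfr := fun x => continuous_C_Re f x Hf).
  assert (Hfi := fun x => continuous_C_Im f x Hf).
  assert (Hgr := fun x => continuous_C_Re g x Hg).
  assert (Hgi := fun x => continuous_C_Im g x Hg).
  unfold CInt. apply (f_equal2 pair); apply is_RInt_unique.
  - apply (is_RInt_minus (V := R_NormedModule)); now apply Hex.
  - apply (is_RInt_plus (V := R_NormedModule)); now apply Hex.
Qed.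

(** For [0 < s < b] the point [t - s] is negative if [t <= 0] and exceeds [d] if [t > b + d], so the
    factor [g (t - s)] is always zero. *)
Lemma laplace_conv_vanishes_outside (b d : R) (f g : R -> C) :
  continuous_C f -> continuous_C g ->
  vanishes_outside b f -> vanishes_outside d g -> 0 <= b ->
  vanishes_outside (b + d) (laplace_conv f g).
Proof.
  intros Hf Hg Hfb Hgd Hb t Ht.
  rewrite (laplace_conv_CInt b d) by assumption.
  unfold CInt. apply injective_projections; apply RInt_eq_0; intros s Hs;
    rewrite Rmin_left, Rmax_right in Hs by lra;
    rewrite (Hgd (t - s)) by lra; now rewrite Cmult_0_r.
Qed.

Lemma continuous_C_laplace_conv (b d : R) (f g : R -> C) :
  continuous_C f -> continuous_C g ->
  vanishes_outside b f -> vanishes_outside d g ->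
  continuous_C (laplace_conv f g).
Proof.
  intros Hf Hg Hfb Hgd t.
  assert (H := fun t => laplace_conv_components b d f g t Hf Hg Hfb Hgd).
  rewrite (functional_extensionality _ _ H).
  split; unfold Re, Im; cbn [fst snd].
  - apply (continuous_minus (V := R_NormedModule));
      apply continuous_truncated_conv; intros x;
      auto using continuous_C_Re, continuous_C_Im.
  - apply (continuous_plus (V := R_NormedModule));
      apply continuous_truncated_conv; intros x;
      auto using continuous_C_Re, continuous_C_Im.
Qed.

(** The four real convolutions integrate to products of real integrals, which recombine by the rule
    for complex multiplication. *)
Lemma CInt_laplace_conv (b d : R) (f g : R -> C) :
  0 <= b -> 0 <= d -> continuous_C f -> continuous_C g ->
  vanishes_outside b f -> vanishes_outside d g ->
  CInt (laplace_conv f g) 0 (b + d) = Cmult (CInt f 0 b) (CInt g 0 d).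
Proof.
  intros Hb Hd Hf Hg Hfb Hgd.
  assert (H := fun t => laplace_conv_components b d f g t Hf Hg Hfb Hgd).
  assert (Hex : forall u v : R -> R,
    (forall x, continuous u x) -> (forall x, continuous v x) ->
    (forall x, x <= 0 -> v x = 0) -> (forall x, d < x -> v x = 0) ->
    is_RInt (truncated_conv b u v) 0 (b + d) (RInt u 0 b * RInt v 0 d)).
  { intros u v Hu Hv Hv0 Hvd.
    rewrite <- (RInt_truncated_conv b d (b + d) u v) by (assumption || lra).
    apply (RInt_correct (V := R_CompleteNormedModule)).
    apply ex_RInt_continuous_R. intros s. now apply continuous_truncated_conv. }
  rewrite (functional_extensionality _ _ H).
  apply (f_equal2 pair); apply is_RInt_unique.
  - apply (is_RInt_minus (V := R_NormedModule)); apply Hex; intros x;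
      auto using continuous_C_Re, continuous_C_Im;
      intros Hx; now rewrite Hgd by auto.
  - apply (is_RInt_plus (V := R_NormedModule)); apply Hex; intros x;
      auto using continuous_C_Re, continuous_C_Im;
      intros Hx; now rewrite Hgd by auto.
Qed.

(** * The exponential kernel and the transform of a convolution *)

Lemma Cexp_plus (z w : C) : Cexp (Cplus z w) = Cmult (Cexp z) (Cexp w).
Proof.
  destruct z as [x y], w as [x' y']. unfold Cexp, Cmult, Cplus, Re, Im; cbn [fst snd].
  rewrite exp_plus, cos_plus, sin_plus. apply (f_equal2 pair); ring.
Qed.

Lemma Cexp_conj (z : C) : Cexp (Cconj z) = Cconj (Cexp z).
Proof.
  destruct z as [x y]. unfold Cexp, Cconj, Re, Im; cbn [fst snd].
  rewrite cos_neg, sin_neg. apply (f_equal2 pair); ring.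
Qed.

Definition laplace_kernel (z : C) (t : R) : C := Cexp (Copp (Cmult (RtoC t) z)).

Lemma laplace_kernel_split (z : C) (s t : R) :
  laplace_kernel z t = Cmult (laplace_kernel z s) (laplace_kernel z (t - s)).
Proof.
  unfold laplace_kernel. rewrite <- Cexp_plus. f_equal.
  rewrite RtoC_minus. ring.
Qed.

Lemma continuous_C_laplace_kernel (z : C) : continuous_C (laplace_kernel z).
Proof.
  intros t. split; unfold laplace_kernel, Cexp; simpl;
    apply (ex_derive_continuous (K := R_AbsRing) (V := R_NormedModule)); auto_derive; auto.
Qed.

(** The integral up to [y] no longer depends on [y] once [y >= b], so the improper integral is a
    proper one. *)
Lemma laplace_CInt (b : R) (f : R -> C) (z : C) :
  0 <= b -> continuous_C f -> vanishes_outside b f ->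
  laplace f z = CInt (fun t => Cmult (laplace_kernel z t) (f t)) 0 b.
Proof.
  intros Hb Hf Hfb.
  assert (Hc := continuous_C_mult _ _ (continuous_C_laplace_kernel z) Hf).
  unfold laplace. change (fun t : R => _) with (fun t => Cmult (laplace_kernel z t) (f t)).
  apply (is_RInt_gen_unique (V := C_R_CompleteNormedModule)
           (Fa := at_point 0) (Fb := Rbar_locally p_infty)).
  intros P HP.
  (* On these sets of limits the integral equals the claimed value exactly, and any neighbourhood
     [P] of that value contains it. *)
  exists (fun x => x = 0) (fun y => b < y); [reflexivity|now exists b|].
  intros x y -> Hy. exists (CInt (fun t => Cmult (laplace_kernel z t) (f t)) 0 y).
  split; [now apply is_RInt_CInt|].
  rewrite (CInt_vanishing_right _ b) by
    (try assumption; try lra; intros t Ht; rewrite Hfb by exact Ht; apply Cmult_0_r).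
  now apply locally_singleton.
Qed.

Lemma laplace_laplace_conv (b d : R) (f g : R -> C) (z : C) :
  0 <= b -> 0 <= d -> continuous_C f -> continuous_C g ->
  vanishes_outside b f -> vanishes_outside d g ->
  laplace (laplace_conv f g) z = Cmult (laplace f z) (laplace g z).
Proof.
  intros Hb Hd Hf Hg Hfb Hgd.
  set (E := laplace_kernel z).
  assert (HE := continuous_C_laplace_kernel z).
  assert (HEf := continuous_C_mult _ _ HE Hf).
  assert (HEg := continuous_C_mult _ _ HE Hg).
  assert (Hv : forall k h, vanishes_outside k h ->
            vanishes_outside k (fun t => Cmult (E t) (h t))).
  { intros k h Hh t Ht. rewrite Hh by exact Ht. apply Cmult_0_r. }
  rewrite (laplace_CInt (b + d)), (laplace_CInt b f), (laplace_CInt d g);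
    try assumption; try lra.
  (* The product of transforms becomes the integral of the convolution of [E f] with [E g]; both
     sides are then integrals over [[0, b + d]] and their integrands are compared at each [t]. *)
  - rewrite <- CInt_laplace_conv by auto.
    f_equal. apply functional_extensionality. intros t.
    rewrite !(laplace_conv_CInt b d) by auto.
    rewrite <- CInt_Cmult by now apply continuous_C_conv_integrand.
    (* The factor [E t], now under the integral in [s], splits into [E s], which goes with [f s],
       and [E (t - s)], which goes with [g (t - s)]. *)
    f_equal. apply functional_extensionality. intros s. fold E.
    unfold E at 1. rewrite (laplace_kernel_split z s t). fold E. ring.
  - now apply (continuous_C_laplace_conv b d).
  - now apply laplace_conv_vanishes_outside.
Qed.

(** * Stability of test functions under convolution and conjugation *)

Lemma smooth_laplace_conv (b d : R) (f g : R -> C) :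
  smooth f -> smooth g -> vanishes_outside b f -> vanishes_outside d g ->
  smooth (laplace_conv f g).
Proof.
  intros Hf Hg Hfb Hgd n t.
  assert (Hcf := continuous_C_smooth f Hf).
  assert (H := fun t => laplace_conv_components b d f g t
                          Hcf (continuous_C_smooth g Hg) Hfb Hgd).
  rewrite (functional_extensionality _ _ H).
  split; unfold Re, Im; cbn [fst snd].
  - apply ex_derive_n_minus; apply filter_forall; intros x k _;
      apply smooth_truncated_conv; intros y;
      auto using continuous_C_Re, continuous_C_Im; intros m; apply Hg.
  - apply ex_derive_n_plus; apply filter_forall; intros x k _;
      apply smooth_truncated_conv; intros y;
      auto using continuous_C_Re, continuous_C_Im; intros m; apply Hg.
Qed.

Lemma test_function_laplace_conv (f g : R -> C) :
  test_function f -> test_function g -> test_function (laplace_conv f g).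
Proof.
  intros [Hf (a & b & Ha & Hab & Hfs)] [Hg (c & d & Hc & Hcd & Hgs)].
  assert (Hfb := supported_in_vanishes_outside a b f Ha Hfs).
  assert (Hgd := supported_in_vanishes_outside c d g Hc Hgs).
  split; [now apply (smooth_laplace_conv b d)|].
  (* Supports add, and the lower end [a + c] stays positive. *)
  exists (a + c), (b + d). split; [lra|]. split; [lra|].
  intros t Ht.
  rewrite (laplace_conv_CInt b d) by (try apply continuous_C_smooth; assumption).
  (* If [s] lay in [[a, b]] and [t - s] in [[c, d]], their sum [t] would lie in [[a + c, b + d]];
     hence one factor vanishes at every [s]. *)
  assert (Hz : forall s, Cmult (f s) (g (t - s)) = RtoC 0).
  { intros s. destruct (Rle_dec a s) as [Has|Has].
    - destruct (Rle_dec s b) as [Hsb|Hsb].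
      + rewrite (Hgs (t - s)) by lra. apply Cmult_0_r.
      + rewrite (Hfs s) by lra. apply Cmult_0_l.
    - rewrite (Hfs s) by lra. apply Cmult_0_l. }
  unfold CInt. apply injective_projections; apply RInt_eq_0; intros s _; now rewrite Hz.
Qed.

Lemma test_function_conj (f : R -> C) :
  test_function f -> test_function (fun s => Cconj (f s)).
Proof.
  intros [Hf (a & b & Ha & Hab & Hfs)]. split.
  - intros n t. split; [apply Hf|]. apply ex_derive_n_opp. apply Hf.
  - exists a, b. repeat split; trivial. intros t Ht. rewrite Hfs by exact Ht.
    unfold Cconj; simpl. now rewrite Ropp_0.
Qed.

Lemma test_function_continuous_vanishes (f : R -> C) :
  test_function f ->
  continuous_C f /\ exists b, 0 <= b /\ vanishes_outside b f.
Proof.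
  intros [Hf (a & b & Ha & Hab & Hfs)]. split; [now apply continuous_C_smooth|].
  exists b. split; [lra|]. now apply (supported_in_vanishes_outside a).
Qed.

(** * Conjugation under the transform, and the identity for [h] and [sigma] *)

Lemma CInt_conj (f : R -> C) (a b : R) :
  continuous_C f -> CInt (fun t => Cconj (f t)) a b = Cconj (CInt f a b).
Proof.
  intros Hf. unfold CInt, Cconj; simpl. f_equal.
  apply (RInt_opp (V := R_CompleteNormedModule)).
  apply ex_RInt_continuous_R. intros x. apply Hf.
Qed.

(** As [t] is real, the kernel at [z] is the conjugate of the kernel at [Cconj z], so one
    conjugation can be taken out of the whole integral. *)
Lemma laplace_conj (f : R -> C) (z : C) :
  test_function f -> laplace (fun s => Cconj (f s)) z = Y_star (laplace f) z.
Proof.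
  intros Hf. unfold Y_star.
  destruct (test_function_continuous_vanishes f Hf) as [Hc (b & Hb & Hv)].
  destruct (test_function_continuous_vanishes _ (test_function_conj f Hf)) as [Hc' _].
  rewrite (laplace_CInt b f), (laplace_CInt b (fun s => Cconj (f s)));
    try assumption.
  - rewrite <- CInt_conj
      by (apply continuous_C_mult; [apply continuous_C_laplace_kernel|exact Hc]).
    f_equal. apply functional_extensionality. intros t.
    rewrite Cmult_conj. f_equal. unfold laplace_kernel.
    rewrite <- Cexp_conj, Copp_conj, Cmult_conj, Cconj_conj. do 3 f_equal.
    unfold Cconj; simpl. now rewrite Ropp_0.
  - intros t Ht. rewrite Hv by exact Ht. unfold Cconj; simpl. now rewrite Ropp_0.
Qed.

Theorem theorem2p3 (h : (R -> C) -> C) (sigma : (C -> C) -> C) :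
  test_dual h ->
  sigma_function h sigma ->
  forall f1 f2 : R -> C, test_function f1 -> test_function f2 ->
    pairing h (laplace_conv (fun s => Cconj (f1 s)) f2) =
    pairing sigma (fun z => Cmult (Y_star (laplace f1) z) (laplace f2 z)).
Proof.
  intros _ [_ Hs] f1 f2 H1 H2.
  assert (H1' := test_function_conj f1 H1).
  rewrite <- Hs by now apply test_function_laplace_conv.
  (* Both sides are now values of [sigma], so it suffices that its arguments agree at every [z]. *)
  unfold laplace_adjoint, pairing. f_equal.
  apply functional_extensionality. intros z.
  destruct (test_function_continuous_vanishes _ H1') as [Hc1 (b & Hb & Hv1)].
  destruct (test_function_continuous_vanishes _ H2) as [Hc2 (d & Hd & Hv2)].
  rewrite (laplace_laplace_conv b d) by assumption.
  now rewrite laplace_conj.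
Qed.
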